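(* Let $F,g:\mathbb R\to\mathbb R$ satisfy (H1) and (H2) of the context, and consider the Liénard system $$\dot x=y-F(x),\qquad \dot y=-g(x).$$ With $a$, $c$, $I$ and $Y$ as in the context, let $v_0$ be the positive zero of $v\mapsto I(v,-a,c)$. If $$\min\left\{Y\left(0;-a,F(c)\right),\,Y\left(0;c,F(c)\right)\right\}\le v_0+F(c),$$ then the amplitude $A_{\text{Lié}}$ of the unique limit cycle of the system satisfies $A_{\text{Lié}}>c$.
   Context: Hypothesis (H1): $F$ and $g$ are odd functions in $C^1(\mathbb R)$, $g(x)>0$ for $x>0$, $F'(0)<0$, $F'$ has a unique positive zero, located at $x=a$, and $\lim_{x\to+\infty}F(x)=+\infty$. Under (H1), $F$ is strictly decreasing on $(-a,a)$ and strictly increasing elsewhere, $F$ has a unique positive zero $b>a$, and the equation $F(x)=F(-a)$ has a unique positive root $c$, with $c>b$. Hypothesis (H2): $F'(x)/g(x)$ is nondecreasing on $(0,c)$. It is classical that under (H1) the system has a unique limit cycle, which is orbitally asymptotically stable, attracts every non-equilibrium solution, and has amplitude greater than $b$. The amplitude of a limit cycle is the maximum of $|x|$ along the orbit. For $v>0$ let $\bar\zeta(v)>c$ be the unique real root of $F(x)-F(c)=v$. For $v>0$ and $x,u<\bar\zeta(v)$ define $$I(v,x,u):=\int_x^u\frac{g(s)}{F(s)-F(c)-v}\,\mathrm ds.$$ Under (H1) and (H2), the function $v\mapsto I(v,-a,c)$ has exactly one zero $v_0$ in $(0,+\infty)$. Orbit graphs: the orbit segments of the system lying above the curve $L_F=\{(x,y):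 y=F(x)\}$ are graphs over $x$. For $(x_0,y_0)\neq(0,0)$ with $y_0\ge F(x_0)$, $y=Y(x;x_0,y_0)$ denotes the graph of the orbit segment above $L_F$ through $(x_0,y_0)$; when $y_0=F(x_0)$, it denotes the adjacent orbit segment above $L_F$ having $(x_0,y_0)$ as an endpoint (this segment leaves the endpoint in forward time if $x_0<0$ and in backward time if $x_0>0$). Note that $F(-a)=F(c)$, so $(-a,F(c))$ and $(c,F(c))$ both lie on $L_F$. *)

(* Defs.v *)
From Stdlib Require Import Reals.
From Coquelicot Require Import Coquelicot.
Open Scope R_scope.

Definition odd_fun (f : R -> R) : Prop := forall x, f (- x) = - f x.

Definition C1 (f : R -> R) : Prop :=
  forall x, ex_derive f x /\ continuous (Derive f) x.

Record H1 (F g : R -> R) (a : R) : Prop := {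
  H1_F_odd : odd_fun F;
  H1_g_odd : odd_fun g;
  H1_F_C1 : C1 F;
  H1_g_C1 : C1 g;
  H1_g_pos : forall x, 0 < x -> 0 < g x;
  H1_dF0 : Derive F 0 < 0;
  H1_a_pos : 0 < a;
  H1_a_zero : Derive F a = 0;
  H1_a_unique : forall x, 0 < x -> Derive F x = 0 -> x = a;
  H1_F_lim : is_lim F p_infty p_infty
}.

Definition H2 (F g : R -> R) (c : R) : Prop :=
  forall x1 x2, 0 < x1 -> x1 <= x2 -> x2 < c ->
    Derive F x1 / g x1 <= Derive F x2 / g x2.

(* Meaningful for 0 < v and x, u smaller than the root of F s - F c = v: the
   denominator is then negative between x and u. *)
Definition I_int (F g : R -> R) (c v x u : R) : R :=
  RInt (fun s => g s / (F s - F c - v)) x u.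

Definition solves_at (F g : R -> R) (x y : R -> R) (t : R) : Prop :=
  is_derive x t (y t - F (x t)) /\ is_derive y t (- g (x t)).

(* Graph of the partial function X |-> Y(X; x0, y0).  The orbit is run from
   (x0, y0) at time t0 to (X, Z) at time t1, forward (t0 < t1) or backward
   (t1 < t0), and is above y = F(x) strictly between these two times.  When
   y0 = F x0 the sign of g x0 leaves only one possible direction: forward if
   x0 < 0, backward if x0 > 0.  Two-sided derivatives at t0 and t1 are no
   restriction, as a solution on a closed interval extends differentiably. *)
Definition Y_graph (F g : R -> R) (x0 y0 X Z : R) : Prop :=
  (x0, y0) <> (0, 0) /\ F x0 <= y0 /\
  exists (x y : R -> R) (t0 t1 : R),
    (forall t, Rmin t0 t1 <= t <= Rmax t0 t1 -> solves_at F g x y t) /\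
    (forall t, Rmin t0 t1 < t < Rmax t0 t1 -> F (x t) < y t) /\
    x t0 = x0 /\ y t0 = y0 /\ x t1 = X /\ y t1 = Z.

Definition periodic_orbit (F g : R -> R) (L : R * R -> Prop) : Prop :=
  exists (x y : R -> R) (T : R),
    (forall t, solves_at F g x y t) /\
    0 < T /\
    (forall t, x (t + T) = x t /\ y (t + T) = y t) /\
    (exists t, (x t, y t) <> (x 0, y 0)) /\
    (forall p, L p <-> exists t, p = (x t, y t)).

(* A limit cycle is an isolated nonconstant periodic orbit: no other one lies
   in a small enough neighbourhood of it. *)
Definition limit_cycle (F g : R -> R) (L : R * R -> Prop) : Prop :=
  periodic_orbit F g L /\
  exists eps : posreal, forall L' : R * R -> Prop,
    periodic_orbit F g L' ->
    (forall q, L' q -> exists p, L p /\ ball p eps q) ->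
    forall q, L' q <-> L q.

Definition is_amplitude (L : R * R -> Prop) (A : R) : Prop :=
  (exists p, L p /\ Rabs (fst p) = A) /\
  (forall p, L p -> Rabs (fst p) <= A).

(* Main.v *)
Require Import Defs.
From Stdlib Require Import Reals Lra Ranalysis5 ClassicalEpsilon.
From Coquelicot Require Import Coquelicot.
Open Scope R_scope.

(* Let [etal] on [[-a, 0]] and [etar] on [[0, c]] be the orbit graphs through
   [(-a, F c)] and [(c, F c)].

   If [Y1 <= v0 + F c] then [Y2 <= Y1].  Replace [y] by the constant [v0 + F c]
   in [dy/dx = - g/(y - F)]: the primitive [J] of [g/(F - F c - v0)] then serves
   as a common clock for both branches, since [J (-a) = J c].  In this clock
   [ln (v0 + F c - F)] has derivative [F'/g], so by [H2] it is convex along the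
   left branch and concave along the right one, with the same end values; hence
   [F] is smaller on the right branch.  Comparing the two differential equations
   at equal clock values, [etar - etal] is nonincreasing where it is positive,
   and it starts from [0].

   If [Y2 <= Y1], a periodic orbit cannot stay in [|x| <= c].  By an energy
   argument it leaves [|x| <= a]; up to the symmetry [(x, y) -> (-x, -y)] it then
   crosses [x = -a] from the left at a height above [F c], stays above [etal], so
   passes [x = 0] above [Y1 >= Y2], and stays above [etar]: as long as [x <= c],
   [x] keeps increasing, which contradicts periodicity. *)

(** * Calculus on an interval: monotonicity, extreme zeros, inverse functions *)

Lemma continuous_pt (f : R -> R) (x : R) : continuous f x -> continuity_pt f x.
Proof. intros H; apply continuity_pt_filterlim; exact H. Qed.

Lemma is_derive_cont (f : R -> R) (x l : R) : is_derive f x l -> continuous f x.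
Proof.
  intros H; apply (ex_derive_continuous (K := R_AbsRing) (V := R_NormedModule)).
  now exists l.
Qed.

Lemma mean_value_open (f df : R -> R) (p q : R) :
  p < q ->
  (forall t, p < t < q -> is_derive f t (df t)) ->
  (forall t, p <= t <= q -> continuous f t) ->
  exists t, p < t < q /\ f q - f p = df t * (q - p).
Proof.
  intros Hpq Hd Hc.
  assert (pr : forall t, p < t < q -> derivable_pt f t).
  { intros t Ht; exists (df t); apply is_derive_Reals, Hd, Ht. }
  destruct (MVT f id p q pr (fun t _ => derivable_pt_id t) Hpq) as [t [Ht E]].
  - intros t Ht; apply continuous_pt, Hc, Ht.
  - intros t Ht; apply derivable_continuous_pt, derivable_pt_id.
  - exists t; split; [exact Ht|].
    rewrite derive_pt_id, Derive_Reals, (is_derive_unique f t (df t)) in E.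
    + unfold id in E; lra.
    + apply Hd, Ht.
Qed.

Lemma derive_pos_lt (f df : R -> R) (p q : R) :
  p < q ->
  (forall t, p < t < q -> is_derive f t (df t)) ->
  (forall t, p <= t <= q -> continuous f t) ->
  (forall t, p < t < q -> 0 < df t) ->
  f p < f q.
Proof.
  intros Hpq Hd Hc Hpos.
  destruct (mean_value_open f df p q Hpq Hd Hc) as [t [Ht E]].
  specialize (Hpos t Ht); nra.
Qed.

Lemma derive_nonneg_le (f df : R -> R) (p q : R) :
  p <= q ->
  (forall t, p < t < q -> is_derive f t (df t)) ->
  (forall t, p <= t <= q -> continuous f t) ->
  (forall t, p < t < q -> 0 <= df t) ->
  f p <= f q.
Proof.
  intros Hpq Hd Hc Hpos.
  destruct Hpq as [Hpq | ->]; [|lra].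
  destruct (mean_value_open f df p q Hpq Hd Hc) as [t [Ht E]].
  specialize (Hpos t Ht); nra.
Qed.

Lemma continuous_pos_near (f : R -> R) (x : R) :
  continuous f x -> 0 < f x ->
  exists d : posreal, forall t, Rabs (t - x) < d -> 0 < f t.
Proof.
  intros Hc Hx.
  destruct (proj1 (filterlim_locally f (f x)) Hc (mkposreal _ Hx)) as [d Hd].
  exists d; intros t Ht; specialize (Hd t Ht).
  change (Rabs (f t - f x) < f x) in Hd.
  apply Rabs_def2 in Hd; lra.
Qed.

(** The zero is the supremum of the [z] such that [f] is positive on all of [[p, z]]. A negative
    value there would persist slightly to the left, where [f] is positive; a positive one would
    persist slightly to the right, past the supremum. *)
Lemma first_zero (f : R -> R) (p q : R) :
  p <= q ->
  (forall t, p <= t <= q -> continuous f t) ->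
  0 < f p -> f q <= 0 ->
  exists z, p < z <= q /\ f z = 0 /\ forall t, p <= t < z -> 0 < f t.
Proof.
  intros Hpq Hc Hp Hq.
  destruct (completeness (fun z => p <= z <= q /\ forall t, p <= t <= z -> 0 < f t))
    as [z [Hub Hlub]].
  - exists q; intros z [Hz _]; lra.
  - exists p; split; [lra|]; intros t Ht; replace t with p by lra; exact Hp.
  - assert (Hpz : p <= z).
    { apply Hub; split; [lra|]; intros t Ht; replace t with p by lra; exact Hp. }
    assert (Hzq : z <= q) by (apply Hlub; intros w [Hw _]; lra).
    assert (Hbefore : forall t, p <= t < z -> 0 < f t).
    { intros t Ht; apply Rnot_le_lt; intros Hft.
      assert (z <= t); [|lra].
      apply Hlub; intros w [Hw Hw']; apply Rnot_lt_le; intros Htw.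
      specialize (Hw' t ltac:(lra)); lra. }
    assert (Hz : f z = 0).
    { destruct (Rtotal_order (f z) 0) as [Hneg | [E | Hpos]]; [|exact E|].
      - destruct (continuous_pos_near (fun t => - f t) z) as [d Hd].
        + apply (continuous_opp f), Hc; lra.
        + lra.
        + assert (p < z) by (destruct Hpz as [| ->]; [assumption|lra]).
          set (t := Rmax p (z - d / 2)).
          assert (Hd0 := cond_pos d).
          assert (Ht : p <= t < z /\ Rabs (t - z) < d).
          { unfold t, Rmax; destruct (Rle_dec p (z - d / 2));
            (split; [lra|apply Rabs_def1; lra]). }
          specialize (Hd t (proj2 Ht)); specialize (Hbefore t (proj1 Ht)); lra.
      - destruct (continuous_pos_near f z) as [d Hd]; [apply Hc; lra|exact Hpos|].
        assert (z < q) by (destruct Hzq as [| ->]; [assumption|lra]).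
        assert (Hd0 := cond_pos d).
        set (w := Rmin q (z + d / 2)).
        assert (Hw : z < w <= q /\ w <= z + d / 2).
        { unfold w, Rmin; destruct (Rle_dec q (z + d / 2)); lra. }
        assert (w <= z); [|lra].
        apply Hub; split; [lra|]; intros t Ht.
        destruct (Rlt_le_dec t z); [apply Hbefore; lra|].
        apply Hd, Rabs_def1; lra. }
    exists z; split; [|split; assumption].
    destruct Hpz as [| ->]; [lra|lra].
Qed.

Lemma last_zero (f : R -> R) (p q : R) :
  p <= q ->
  (forall t, p <= t <= q -> continuous f t) ->
  f p <= 0 -> 0 < f q ->
  exists z, p <= z < q /\ f z = 0 /\ forall t, z < t <= q -> 0 < f t.
Proof.
  intros Hpq Hc Hp Hq.
  destruct (first_zero (fun t => f (- t)) (- q) (- p)) as [z [Hz [E Hpos]]].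
  - lra.
  - intros t Ht; apply (continuous_comp Ropp f).
    + apply (is_derive_cont Ropp t (- 1)); auto_derive; [exact I|ring].
    + apply Hc; lra.
  - now rewrite Ropp_involutive.
  - now rewrite Ropp_involutive.
  - exists (- z); split; [lra|split; [exact E|]].
    intros t Ht; rewrite <- (Ropp_involutive t); apply Hpos; lra.
Qed.

(** A monotone function is discontinuous only by jumps, and a jump would leave a gap in the range.
    The points sent to [f s + e / 2] and [f s - e / 2] bound the neighbourhood of [s]; when such a
    value falls outside [[p, q]], that side needs no bound. *)
Lemma monotone_onto_continuous (f : R -> R) (p q : R) :
  (forall s t, s <= t -> f s <= f t) ->
  (forall s, p <= f s <= q) ->
  (forall y, p <= y <= q -> exists s, f s = y) ->
  forall s, continuous f s.
Proof.
  intros Hmon Hran Honto s.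
  apply filterlim_locally; intros e.
  assert (He := cond_pos e).
  assert (Hr : exists d : posreal, forall t, t - s < d -> f t < f s + e).
  { destruct (Rlt_le_dec q (f s + e / 2)) as [H|H].
    - exists (mkposreal 1 Rlt_0_1); intros t _; specialize (Hran t); lra.
    - destruct (Honto (f s + e / 2)) as [w Hw]; [specialize (Hran s); lra|].
      assert (Hsw : s < w).
      { apply Rnot_le_lt; intros C; specialize (Hmon _ _ C); lra. }
      assert (Hd : 0 < w - s) by lra.
      exists (mkposreal _ Hd); simpl; intros t Ht.
      specialize (Hmon t w ltac:(lra)); lra. }
  assert (Hl : exists d : posreal, forall t, s - t < d -> f s - e < f t).
  { destruct (Rlt_le_dec (f s - e / 2) p) as [H|H].
    - exists (mkposreal 1 Rlt_0_1); intros t _; specialize (Hran t); lra.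
    - destruct (Honto (f s - e / 2)) as [w Hw]; [specialize (Hran s); lra|].
      assert (Hsw : w < s).
      { apply Rnot_le_lt; intros C; specialize (Hmon _ _ C); lra. }
      assert (Hd : 0 < s - w) by lra.
      exists (mkposreal _ Hd); simpl; intros t Ht.
      specialize (Hmon w t ltac:(lra)); lra. }
  destruct Hr as [d1 H1], Hl as [d2 H2].
  assert (Hd : 0 < Rmin d1 d2) by (apply Rmin_glb_lt; apply cond_pos).
  exists (mkposreal _ Hd); intros t Ht.
  change (Rabs (t - s) < Rmin d1 d2) in Ht.
  change (Rabs (f t - f s) < e).
  apply Rabs_def2 in Ht; assert (A := Rmin_l d1 d2); assert (B := Rmin_r d1 d2).
  apply Rabs_def1.
  - specialize (H1 t ltac:(lra)); lra.
  - specialize (H2 t ltac:(lra)); lra.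
Qed.

(* Since [tau] is constant outside [[sigma p, sigma q]], it is continuous on the
   whole line, even where [dsigma] vanishes at an end point. *)
Lemma increasing_inverse (sigma dsigma : R -> R) (p q : R) :
  p < q ->
  (forall t, p <= t <= q -> is_derive sigma t (dsigma t)) ->
  (forall t, p < t < q -> 0 < dsigma t) ->
  sigma p < sigma q /\
  exists tau : R -> R,
    (forall s, continuous tau s) /\
    (forall s, s <= sigma p -> tau s = p) /\
    (forall s, sigma q <= s -> tau s = q) /\
    (forall s, sigma p <= s <= sigma q -> sigma (tau s) = s) /\
    (forall s, sigma p < s < sigma q -> p < tau s < q) /\
    (forall s, sigma p < s < sigma q -> is_derive tau s (/ dsigma (tau s))).
Proof.
  intros Hpq Hd Hpos.
  assert (Hc : forall t, p <= t <= q -> continuous sigma t).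
  { intros t Ht; eapply is_derive_cont, Hd, Ht. }
  assert (Hinc : forall s t, p <= s -> s < t -> t <= q -> sigma s < sigma t).
  { intros s t Hs Hst Ht; apply derive_pos_lt with dsigma; [lra|..];
      intros w Hw; [apply Hd|apply Hc|apply Hpos]; lra. }
  split; [apply Hinc; lra|].
  set (clamp := fun s => Rmax (sigma p) (Rmin (sigma q) s)).
  assert (Hpq' : sigma p < sigma q) by (apply Hinc; lra).
  assert (Hcl : forall s, sigma p <= clamp s <= sigma q).
  { intros s; unfold clamp, Rmax, Rmin.
    repeat destruct Rle_dec; lra. }
  assert (Hcl1 : forall s, sigma p <= s <= sigma q -> clamp s = s).
  { intros s Hs; unfold clamp, Rmax, Rmin.
    repeat destruct Rle_dec; lra. }
  assert (Hclm : forall s t, s <= t -> clamp s <= clamp t).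
  { intros s t Hst; unfold clamp, Rmax, Rmin.
    repeat destruct Rle_dec; lra. }
  assert (Hex : forall s, exists t, p <= t <= q /\ sigma t = clamp s).
  { intros s; specialize (Hcl s).
    (* [last_zero] asks for a strictly positive value at the right end, so the top value [sigma q]
       is treated apart. *)
    destruct (Rle_lt_dec (sigma q) (clamp s)) as [E|E].
    { exists q; split; lra. }
    destruct (last_zero (fun t => sigma t - clamp s) p q) as [z [Hz [Ez _]]];
      [lra| |lra|lra|exists z; split; lra].
    intros t Ht; apply (continuous_minus sigma (fun _ => clamp s));
      [now apply Hc|apply continuous_const]. }
  set (tau := fun s => proj1_sig (constructive_indefinite_description _ (Hex s))).
  assert (Htau : forall s, p <= tau s <= q /\ sigma (tau s) = clamp s).
  { intros s; exact (proj2_sig (constructive_indefinite_description _ (Hex s))). }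
  clearbody tau.
  assert (Hinj : forall s t, p <= s <= q -> p <= t <= q -> sigma s <= sigma t -> s <= t).
  { intros s t Hs Ht Hst; apply Rnot_lt_le; intros C.
    specialize (Hinc t s ltac:(lra) C ltac:(lra)); lra. }
  assert (Hleft : forall t, p <= t <= q -> tau (sigma t) = t).
  { intros t Ht.
    assert (Hst : sigma p <= sigma t <= sigma q).
    { destruct (Req_dec t p) as [->|]; [lra|].
      destruct (Req_dec t q) as [->|]; [lra|].
      split; left; apply Hinc; lra. }
    destruct (Htau (sigma t)) as [Hr E]; rewrite Hcl1 in E by exact Hst.
    apply Rle_antisym; apply Hinj; lra. }
  assert (Hright : forall s, sigma p <= s <= sigma q -> sigma (tau s) = s).
  { intros s Hs; rewrite (proj2 (Htau s)); now apply Hcl1. }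
  assert (Hcont : forall s, continuous tau s).
  { apply monotone_onto_continuous with p q.
    - intros s t Hst; apply Hinj; try apply Htau.
      rewrite !(proj2 (Htau _)); now apply Hclm.
    - intros s; apply Htau.
    - intros y Hy; exists (sigma y); now apply Hleft. }
  assert (Hin : forall s, sigma p < s < sigma q -> p < tau s < q).
  { intros s Hs; assert (E := Hright s ltac:(lra)).
    destruct (proj1 (Htau s)) as [[A|A] [B|B]]; try lra;
      [rewrite B in E|rewrite <- A in E]; lra. }
  exists tau.
  split; [exact Hcont|split; [|split; [|split; [exact Hright|split; [exact Hin|]]]]].
  - intros s Hs; rewrite <- (Hleft p) by lra.
    apply Rle_antisym; apply Hinj; try apply Htau; try lra;
    rewrite !(proj2 (Htau _)).
    + apply Hclm; lra.
    + rewrite (Hcl1 (sigma p)) by lra; apply Hcl.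
  - intros s Hs; rewrite <- (Hleft q) by lra.
    apply Rle_antisym; apply Hinj; try apply Htau; try lra;
    rewrite !(proj2 (Htau _)).
    + rewrite (Hcl1 (sigma q)) by lra; apply Hcl.
    + apply Hclm; lra.
  - intros s Hs; apply is_derive_Reals.
    assert (Hrange : forall t, tau (sigma p) <= t <= tau (sigma q) -> derivable_pt sigma t).
    { intros t Ht; rewrite !Hleft in Ht by lra.
      exists (dsigma t); apply is_derive_Reals, Hd, Ht. }
    assert (Hmid : tau (sigma p) <= tau s <= tau (sigma q)).
    { rewrite !Hleft by lra; specialize (Hin s Hs); lra. }
    assert (E : derive_pt sigma (tau s) (Hrange (tau s) Hmid) = dsigma (tau s)).
    { rewrite Derive_Reals; apply is_derive_unique, Hd.
      specialize (Hin s Hs); lra. }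
    replace (/ dsigma (tau s)) with (1 / derive_pt sigma (tau s) (Hrange (tau s) Hmid)).
    + apply (derivable_pt_lim_recip_interv sigma tau (sigma p) (sigma q));
        [apply continuous_pt, Hcont|assumption|exact Hs|exact Hright|].
      rewrite E; specialize (Hpos _ (Hin s Hs)); lra.
    + rewrite E; unfold Rdiv; ring.
Qed.

(** * Orbit segments above the curve as graphs over [x] *)

(** Above the curve [x] increases with time, so [eta] is [y] composed with the inverse of [x]. An
    end point may lie on the curve, where the slope formula breaks down; only continuity is claimed
    there. *)
Lemma orbit_graph (F g x y : R -> R) (p q : R) :
  p < q ->
  (forall t, p <= t <= q -> solves_at F g x y t) ->
  (forall t, p < t < q -> F (x t) < y t) ->
  x p < x q /\
  exists eta : R -> R,
    (forall z, continuous eta z) /\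
    (forall z, z <= x p -> eta z = y p) /\
    (forall z, x q <= z -> eta z = y q) /\
    (forall z, x p < z < x q ->
       F z < eta z /\ is_derive eta z (- g z / (eta z - F z))).
Proof.
  intros Hpq Hsol Habove.
  destruct (increasing_inverse x (fun t => y t - F (x t)) p q Hpq)
    as [Hx [tau [Hcont [Hlo [Hhi [Hinv [Hin Hder]]]]]]].
  - intros t Ht; apply (Hsol t Ht).
  - intros t Ht; specialize (Habove t Ht); lra.
  - split; [exact Hx|].
    exists (fun z => y (tau z)); split; [|split; [|split]].
    + intros z; apply continuous_comp; [apply Hcont|].
      assert (Hz : p <= tau z <= q).
      { destruct (Rle_lt_dec z (x p)) as [A|A]; [rewrite (Hlo z A); lra|].
        destruct (Rle_lt_dec (x q) z) as [B|B]; [rewrite (Hhi z B); lra|].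
        specialize (Hin z ltac:(lra)); lra. }
      exact (is_derive_cont _ _ _ (proj2 (Hsol _ Hz))).
    + intros z Hz; now rewrite Hlo.
    + intros z Hz; now rewrite Hhi.
    + intros z Hz; assert (Ez := Hinv z ltac:(lra)).
      assert (Ht := Hin z Hz); assert (Ha := Habove _ Ht); rewrite Ez in Ha.
      split; [exact Ha|].
      replace (- g z / (y (tau z) - F z))
        with (scal (/ (y (tau z) - F (x (tau z)))) (- g (x (tau z)))).
      * apply (is_derive_comp y tau); [apply Hsol; lra|exact (Hder z Hz)].
      * unfold scal; simpl; unfold mult; simpl; rewrite Ez; unfold Rdiv; ring.
Qed.

(** * Signs and monotonicity under (H1) *)

Lemma H1_g_neg (F g : R -> R) (a x : R) : H1 F g a -> x < 0 -> g x < 0.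
Proof.
  intros H Hx; assert (A := H1_g_pos _ _ _ H (- x) ltac:(lra)).
  rewrite (H1_g_odd _ _ _ H) in A; lra.
Qed.

Lemma odd_fun_0 (f : R -> R) : odd_fun f -> f 0 = 0.
Proof. intros H; specialize (H 0); rewrite Ropp_0 in H; lra. Qed.

Lemma C1_is_derive (f : R -> R) (x : R) : Defs.C1 f -> is_derive f x (Derive f x).
Proof. intros H; apply Derive_correct, H. Qed.

Lemma C1_continuous (f : R -> R) (x : R) : Defs.C1 f -> continuous f x.
Proof. intros H; eapply is_derive_cont, C1_is_derive, H. Qed.

Lemma odd_Derive_even (f : R -> R) (x : R) :
  odd_fun f -> Defs.C1 f -> Derive f (- x) = Derive f x.
Proof.
  intros Ho H.
  assert (A : is_derive (fun t => - f (- t)) x (Derive f (- x))).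
  { auto_derive; [apply H|].
    change (fun z => f z) with f; ring. }
  rewrite <- (is_derive_unique _ _ _ A); apply Derive_ext; intros t.
  rewrite (Ho t); ring.
Qed.

(** [F'] is negative at [0]; a nonnegative value before [a] would create a positive zero of [F']
    other than [a]. The negative side follows because [F'] is even. *)
Lemma H1_dF_neg (F g : R -> R) (a x : R) :
  H1 F g a -> - a < x < a -> Derive F x < 0.
Proof.
  intros H.
  assert (Hp : forall z, 0 <= z < a -> Derive F z < 0).
  { intros z Hz; apply Rnot_le_lt; intros C.
    destruct (first_zero (fun t => - Derive F t) 0 z) as [w [Hw [E _]]];
      [lra| |assert (A := H1_dF0 _ _ _ H); lra|lra|].
    - intros t _; apply (continuous_opp (Derive F)), (H1_F_C1 _ _ _ H).
    - assert (A := H1_a_unique _ _ _ H w ltac:(lra) ltac:(lra)); lra. }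
  intros Hx; destruct (Rle_lt_dec 0 x) as [A|A]; [apply Hp; lra|].
  rewrite <- (Ropp_involutive x), odd_Derive_even; try apply H; apply Hp; lra.
Qed.

Lemma H1_F_decreasing (F g : R -> R) (a x z : R) :
  H1 F g a -> - a <= x -> x < z -> z <= a -> F z < F x.
Proof.
  intros H Hx Hxz Hz; apply Ropp_lt_cancel.
  apply (derive_pos_lt (fun t => - F t) (fun t => - Derive F t)); [exact Hxz|..].
  - intros t _; apply (is_derive_opp F), C1_is_derive, H.
  - intros t _; apply (continuous_opp F), C1_continuous, H.
  - intros t Ht; assert (A := H1_dF_neg _ _ _ t H ltac:(lra)); lra.
Qed.

Lemma H1_F_neg (F g : R -> R) (a x : R) : H1 F g a -> 0 < x <= a -> F x < 0.
Proof.
  intros H Hx; rewrite <- (odd_fun_0 F) by apply H.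
  assert (A := H1_a_pos _ _ _ H); apply (H1_F_decreasing F g a); trivial; lra.
Qed.

Lemma H1_Fc_pos (F g : R -> R) (a c : R) : H1 F g a -> F c = F (- a) -> 0 < F c.
Proof.
  intros H Hc; rewrite Hc, (H1_F_odd _ _ _ H).
  assert (A := H1_a_pos _ _ _ H); assert (B := H1_F_neg F g a a H); lra.
Qed.

Lemma H1_a_lt_c (F g : R -> R) (a c : R) :
  H1 F g a -> 0 < c -> F c = F (- a) -> a < c.
Proof.
  intros H Hc0 Hc; assert (A := H1_Fc_pos F g a c H Hc).
  apply Rnot_le_lt; intros C; assert (B := H1_F_neg F g a c H); lra.
Qed.

(** Since [F a < 0 < F c], the mean value theorem gives a point of [(a, c)] where [F'] is positive.
    As [F'] has no zero beyond [a], it keeps this sign. *)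
Lemma H1_dF_pos (F g : R -> R) (a c x : R) :
  H1 F g a -> 0 < c -> F c = F (- a) -> a < x -> 0 < Derive F x.
Proof.
  intros H Hc0 Hc Hx.
  assert (Ha := H1_a_pos _ _ _ H).
  assert (Hac := H1_a_lt_c _ _ _ _ H Hc0 Hc).
  assert (HFc := H1_Fc_pos _ _ _ _ H Hc).
  assert (HFa := H1_F_neg F g a a H ltac:(lra)).
  destruct (mean_value_open F (Derive F) a c Hac) as [w [Hw Ew]];
    [intros; apply C1_is_derive, H|intros; apply C1_continuous, H|].
  assert (Hdw : 0 < Derive F w) by nra.
  assert (HdC : forall t, continuous (Derive F) t) by apply (H1_F_C1 _ _ _ H).
  apply Rnot_le_lt; intros C.
  destruct (Rle_lt_dec w x) as [D|D].
  - destruct (first_zero (Derive F) w x) as [z [Hz [Ez _]]]; auto.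
    assert (A := H1_a_unique _ _ _ H z ltac:(lra) Ez); lra.
  - destruct (last_zero (Derive F) x w) as [z [Hz [Ez _]]]; auto; [lra|].
    assert (A := H1_a_unique _ _ _ H z ltac:(lra) Ez); lra.
Qed.

(** [F] rises up to [-a], where it equals [F c], falls until [a], then rises to [F c] again at
    [c]. *)
Lemma H1_F_le_Fc (F g : R -> R) (a c x : R) :
  H1 F g a -> 0 < c -> F c = F (- a) -> x <= c -> F x <= F c.
Proof.
  intros H Hc0 Hc Hx.
  assert (HdF : forall t, is_derive F t (Derive F t)) by (intros; apply C1_is_derive, H).
  assert (HC : forall t, continuous F t) by (intros; apply C1_continuous, H).
  assert (Ha := H1_a_pos _ _ _ H).
  destruct (Rle_lt_dec a x) as [A|A].
  - apply (derive_nonneg_le F (Derive F)); auto.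
    intros t Ht; left; apply (H1_dF_pos F g a c); auto; lra.
  - destruct (Rle_lt_dec x (- a)) as [B|B].
    + rewrite Hc; apply (derive_nonneg_le F (Derive F)); auto.
      intros t Ht; left.
      rewrite <- (Ropp_involutive t), odd_Derive_even by apply H.
      apply (H1_dF_pos F g a c); auto; lra.
    + rewrite Hc; left; apply (H1_F_decreasing F g a); auto; lra.
Qed.

(** * The common clock and the comparison of the two branches *)

Lemma continuous_Rmin_const (f : R -> R) (M x : R) :
  continuous f x -> continuous (fun t => Rmin (f t) M) x.
Proof.
  intros Hf; apply filterlim_locally; intros e.
  generalize (proj1 (filterlim_locally f (f x)) Hf e); apply filter_imp.
  intros t Ht; change (Rabs (f t - f x) < e) in Ht.
  change (Rabs (Rmin (f t) M - Rmin (f x) M) < e).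
  assert (He := cond_pos e).
  apply Rabs_def2 in Ht; apply Rabs_def1; unfold Rmin; repeat destruct Rle_dec; lra.
Qed.

(* Truncating [F] at [F c], which changes nothing on [[-a, c]], makes the
   integrand of [I_int] continuous on the whole line. *)
Lemma frozen_clock_primitive (F g : R -> R) (a c v : R) :
  H1 F g a -> 0 < c -> F c = F (- a) -> 0 < v -> I_int F g c v (- a) c = 0 ->
  exists J : R -> R,
    J (- a) = J c /\ J 0 = 0 /\
    forall x, x <= c -> is_derive J x (g x / (F x - F c - v)).
Proof.
  intros H Hc0 Hc Hv HI.
  assert (Ha := H1_a_pos _ _ _ H).
  set (k := fun x => g x / (Rmin (F x) (F c) - F c - v)).
  assert (Hden : forall x, Rmin (F x) (F c) - F c - v < 0).
  { intros x; assert (A := Rmin_r (F x) (F c)); lra. }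
  assert (Hk : forall x, continuous k x).
  { intros x; unfold k, Rdiv; apply (continuous_mult g); [apply C1_continuous, H|].
    apply continuous_Rinv_comp; [|specialize (Hden x); lra].
    apply (continuous_minus (fun x => Rmin (F x) (F c) - F c) (fun _ => v));
      [|apply continuous_const].
    apply (continuous_minus (fun x => Rmin (F x) (F c)) (fun _ => F c));
      [|apply continuous_const].
    apply continuous_Rmin_const, C1_continuous, H. }
  assert (Hkx : forall x, x <= c -> k x = g x / (F x - F c - v)).
  { intros x Hx; unfold k; rewrite Rmin_left; [reflexivity|].
    now apply (H1_F_le_Fc F g a). }
  assert (Hex : forall p q, ex_RInt k p q).
  { intros p q; apply (ex_RInt_continuous k); auto. }
  exists (RInt k 0); split; [|split].
  - assert (E : RInt k (- a) c = 0).
    { rewrite <- HI; unfold I_int; apply RInt_ext; intros x Hx.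
      rewrite Rmin_left, Rmax_right in Hx by lra; apply Hkx; lra. }
    assert (A := RInt_Chasles k 0 (- a) c (Hex _ _) (Hex _ _)).
    unfold plus in A; simpl in A; lra.
  - apply (RInt_point 0 k).
  - intros x Hx; rewrite <- Hkx by exact Hx.
    apply (is_derive_RInt k (RInt k 0) 0 x); [|apply Hk].
    apply filter_forall; intros z; apply (RInt_correct k), Hex.
Qed.

(* Both branches run through the values [j] of the same primitive [J]: by
   [I_int = 0] they start together, at [-a] and at [c], and meet at [0]. *)
Lemma frozen_branches (F g : R -> R) (a c v : R) :
  H1 F g a -> 0 < c -> F c = F (- a) -> 0 < v -> I_int F g c v (- a) c = 0 ->
  exists (j0 : R) (xl xr : R -> R),
    j0 < 0 /\
    (forall j, continuous xl j) /\ (forall j, continuous xr j) /\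
    xl j0 = - a /\ xl 0 = 0 /\ xr j0 = c /\ xr 0 = 0 /\
    forall j, j0 < j < 0 ->
      - a < xl j < 0 /\ 0 < xr j < c /\
      is_derive xl j ((F (xl j) - F c - v) / g (xl j)) /\
      is_derive xr j ((F (xr j) - F c - v) / g (xr j)).
Proof.
  intros H Hc0 Hc Hv HI.
  assert (Ha := H1_a_pos _ _ _ H).
  assert (Hac := H1_a_lt_c _ _ _ _ H Hc0 Hc).
  destruct (frozen_clock_primitive F g a c v) as [J [EJ [J0 HJ]]]; trivial.
  set (k := fun x => g x / (F x - F c - v)).
  assert (Hden : forall x, x <= c -> F x - F c - v < 0).
  { intros x Hx; assert (A := H1_F_le_Fc F g a c x); intuition lra. }
  assert (Hpos : forall x, x < 0 -> 0 < k x).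
  { intros x Hx; unfold k.
    replace (g x / (F x - F c - v)) with (- g x / - (F x - F c - v))
      by (field; specialize (Hden x); lra).
    apply Rdiv_lt_0_compat; [assert (A := H1_g_neg _ _ _ x H Hx); lra|].
    specialize (Hden x); lra. }
  assert (Hneg : forall x, 0 < x <= c -> 0 < - k x).
  { intros x Hx; unfold k.
    replace (- (g x / (F x - F c - v))) with (g x / - (F x - F c - v))
      by (field; specialize (Hden x); lra).
    apply Rdiv_lt_0_compat; [apply (H1_g_pos _ _ _ H); lra|].
    specialize (Hden x); lra. }
  (* [J] increases on [[-a, 0]], decreases on [[0, c]] and peaks at [J 0 = 0], so each clock value
     is taken once on either side. On the right it is [- J] that is inverted, and the sign of the
     clock is then restored. *)
  destruct (increasing_inverse J k (- a) 0) as
    [Hl [xl [Cl [Ll [Ul [_ [Il Dl]]]]]]];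
    [lra|intros x Hx; apply HJ; lra|intros x Hx; apply Hpos; lra|].
  destruct (increasing_inverse (fun x => - J x) (fun x => - k x) 0 c) as
    [_ [xr [Cr [Lr [Ur [_ [Ir Dr]]]]]]];
    [lra|intros x Hx; apply (is_derive_opp J), HJ; lra|intros x Hx; apply Hneg; lra|].
  rewrite J0 in *.
  assert (CN : forall j, continuous (fun j => xr (- j)) j).
  { intros j; apply (continuous_comp Ropp xr); [|apply Cr].
    apply (is_derive_cont Ropp j (- 1)); auto_derive; [exact I|ring]. }
  exists (J (- a)), xl, (fun j => xr (- j)).
  split; [exact Hl|split; [exact Cl|split; [exact CN|]]].
  split; [apply Ll; lra|split; [apply Ul; lra|]].
  split; [apply Ur; lra|split; [apply Lr; lra|]].
  intros j Hj; assert (A := Il j Hj); assert (B := Ir (- j) ltac:(lra)).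
  split; [exact A|split; [exact B|split]].
  - replace ((F (xl j) - F c - v) / g (xl j)) with (/ k (xl j)); [exact (Dl j Hj)|].
    unfold k; assert (G := H1_g_neg _ _ _ (xl j) H ltac:(lra)).
    specialize (Hden (xl j)); field; repeat split; lra.
  - replace ((F (xr (- j)) - F c - v) / g (xr (- j)))
      with (scal (- 1) (/ - k (xr (- j)))).
    + apply (is_derive_comp xr Ropp); [apply Dr; lra|].
      auto_derive; [exact I|ring].
    + assert (G := H1_g_pos _ _ _ H (xr (- j)) ltac:(lra)).
      unfold k, scal; simpl; unfold mult; simpl.
      specialize (Hden (xr (- j))); field; repeat split; lra.
Qed.

(** A negative value at [t] would give a negative mean slope on [[p, t]] and a positive one on
    [[t, q]], whereas slopes cannot increase. *)
Lemma concave_nonneg (f df : R -> R) (p q t : R) :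
  (forall s, p < s < q -> is_derive f s (df s)) ->
  (forall s, p <= s <= q -> continuous f s) ->
  (forall s s', p < s -> s < s' -> s' < q -> df s' <= df s) ->
  f p = 0 -> f q = 0 -> p <= t <= q -> 0 <= f t.
Proof.
  intros Hd Hc Hmon Hp Hq Ht.
  apply Rnot_lt_le; intros C.
  destruct (proj1 Ht) as [A | <-]; [|lra].
  destruct (proj2 Ht) as [B | ->]; [|lra].
  destruct (mean_value_open f df p t A) as [s [Hs Es]];
    [intros; apply Hd; lra|intros; apply Hc; lra|].
  destruct (mean_value_open f df t q B) as [s' [Hs' Es']];
    [intros; apply Hd; lra|intros; apply Hc; lra|].
  specialize (Hmon s s' ltac:(lra) ltac:(lra) ltac:(lra)).
  assert (df s < 0) by nra.
  assert (0 < df s') by nra.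
  lra.
Qed.

(** In the clock, [P X] has derivative [F'/g] along the branch [X]. The difference [P xr - P xl] is
    concave by (H2) and vanishes at both ends, because [F (-a) = F c] and both branches end at [0];
    so it is nonnegative, and [ln] is increasing. *)
Lemma frozen_branches_F_le (F g : R -> R) (a c v j0 : R) (xl xr : R -> R) :
  H1 F g a -> 0 < c -> F c = F (- a) -> 0 < v -> H2 F g c ->
  (forall j, continuous xl j) -> (forall j, continuous xr j) ->
  xl j0 = - a -> xl 0 = 0 -> xr j0 = c -> xr 0 = 0 ->
  (forall j, j0 < j < 0 ->
      - a < xl j < 0 /\ 0 < xr j < c /\
      is_derive xl j ((F (xl j) - F c - v) / g (xl j)) /\
      is_derive xr j ((F (xr j) - F c - v) / g (xr j))) ->
  forall j, j0 <= j <= 0 -> F (xr j) <= F (xl j).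
Proof.
  intros H Hc0 Hc Hv HH2 Cl Cr El0 El1 Er0 Er1 Hj j Hjj.
  assert (Ha := H1_a_pos _ _ _ H).
  assert (Hac := H1_a_lt_c _ _ _ _ H Hc0 Hc).
  assert (Hden : forall x, x <= c -> 0 < v + F c - F x).
  { intros x Hx; assert (A := H1_F_le_Fc F g a c x); intuition lra. }
  assert (Hxc : forall s, j0 <= s <= 0 -> xl s <= c /\ xr s <= c).
  { intros s Hs; destruct (Req_dec s j0) as [->|]; [lra|].
    destruct (Req_dec s 0) as [->|]; [lra|].
    specialize (Hj s ltac:(lra)); lra. }
  set (P := fun (X : R -> R) s => ln (v + F c - F (X s))).
  assert (HPd : forall X s, X s <= c -> g (X s) <> 0 ->
    is_derive X s ((F (X s) - F c - v) / g (X s)) ->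
    is_derive (P X) s (Derive F (X s) / g (X s))).
  { intros X s HX Hg HdX; specialize (Hden _ HX); unfold P.
    replace (Derive F (X s) / g (X s)) with
      (scal (- ((F (X s) - F c - v) / g (X s) * Derive F (X s))) (/ (v + F c - F (X s)))).
    - apply (is_derive_comp ln (fun s => v + F c - F (X s))); [now apply is_derive_ln|].
      auto_derive; [split; [apply H|split; [now exists ((F (X s) - F c - v) / g (X s))|exact I]]|].
      change (fun x => X x) with X; change (fun x => F x) with F.
      rewrite (is_derive_unique X s _ HdX); ring.
    - unfold scal; simpl; unfold mult; simpl; field; repeat split; lra. }
  assert (HPc : forall X s, X s <= c -> continuous X s -> continuous (P X) s).
  { intros X s HX HXc; specialize (Hden _ HX); unfold P.
    apply (continuous_comp (fun s => v + F c - F (X s)) ln).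
    - apply (continuous_minus (fun _ => v + F c) (fun s => F (X s)));
        [apply continuous_const|].
      apply (continuous_comp X F); [exact HXc|apply C1_continuous, H].
    - eapply is_derive_cont, is_derive_ln, Hden. }
  assert (Hle : 0 <= P xr j - P xl j).
  { apply (concave_nonneg (fun s => P xr s - P xl s)
      (fun s => Derive F (xr s) / g (xr s) - Derive F (xl s) / g (xl s)) j0 0).
    - intros s Hs; destruct (Hj s Hs) as [A [B [DA DB]]].
      apply (is_derive_minus (P xr) (P xl)); apply HPd; trivial; try lra.
      + assert (G := H1_g_pos _ _ _ H (xr s) ltac:(lra)); lra.
      + assert (G := H1_g_neg _ _ _ (xl s) H ltac:(lra)); lra.
    - intros s Hs; apply (continuous_minus (P xr) (P xl)); apply HPc; auto; now apply Hxc.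
    - assert (Hlr : forall s s', j0 < s -> s < s' -> s' < 0 ->
        xl s < xl s' /\ xr s' < xr s).
      { intros s s' Hs Hss' Hs'; split; [|apply Ropp_lt_cancel].
        - apply (derive_pos_lt xl (fun s => (F (xl s) - F c - v) / g (xl s))); auto;
            intros w Hw; destruct (Hj w ltac:(lra)) as [A [B [DA DB]]]; trivial.
          replace ((F (xl w) - F c - v) / g (xl w))
            with ((v + F c - F (xl w)) / - g (xl w))
            by (assert (G := H1_g_neg _ _ _ (xl w) H ltac:(lra)); field; repeat split; lra).
          apply Rdiv_lt_0_compat; [apply Hden; lra|].
          assert (G := H1_g_neg _ _ _ (xl w) H ltac:(lra)); lra.
        - apply (derive_pos_lt (fun s => - xr s)
            (fun s => - ((F (xr s) - F c - v) / g (xr s)))); auto;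
            intros w Hw; [|apply (continuous_opp xr), Cr|];
            destruct (Hj w ltac:(lra)) as [A [B [DA DB]]].
          + apply (is_derive_opp xr), DB.
          + assert (G := H1_g_pos _ _ _ H (xr w) ltac:(lra)).
            replace (- ((F (xr w) - F c - v) / g (xr w)))
              with ((v + F c - F (xr w)) / g (xr w)) by (field; repeat split; lra).
            apply Rdiv_lt_0_compat; [apply Hden; lra|lra]. }
      intros s s' Hs Hss' Hs'; destruct (Hlr s s') as [A B]; trivial.
      destruct (Hj s ltac:(lra)) as [A1 [B1 _]], (Hj s' ltac:(lra)) as [A2 [B2 _]].
      assert (Q := HH2 (xr s') (xr s) ltac:(lra) ltac:(lra) ltac:(lra)).
      (* (H2) speaks of positive arguments; it is applied at [- xl], and since [F'] is even and [g]
         odd, returning to [xl] changes the sign of the quotient. *)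
      assert (Q' := HH2 (- xl s') (- xl s) ltac:(lra) ltac:(lra) ltac:(lra)).
      rewrite !odd_Derive_even, !(H1_g_odd _ _ _ H), !Rdiv_opp_r in Q' by apply H.
      lra.
    - unfold P; rewrite El0, Er0, Hc; ring.
    - unfold P; rewrite El1, Er1; ring.
    - exact Hjj. }
  destruct (Hxc j Hjj) as [A B].
  apply Rnot_lt_le; intros C.
  assert (P xr j < P xl j); [|lra].
  apply ln_increasing; [apply Hden; exact B|lra].
Qed.

(** If [D], the right height minus the left one at equal clock values, were positive at clock [0],
    it would be positive since its last zero [z]. There [dD], the derivative of [- D], is
    nonnegative, so [D 0 <= D z = 0]. *)
Lemma left_height_le_right_height (F g : R -> R) (a c v : R) (etal etar : R -> R) :
  H1 F g a -> 0 < c -> F c = F (- a) -> 0 < v -> I_int F g c v (- a) c = 0 ->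
  H2 F g c ->
  (forall z, continuous etal z) -> (forall z, continuous etar z) ->
  etal (- a) = F c -> etar c = F c ->
  (forall z, - a < z < 0 ->
     F z < etal z /\ is_derive etal z (- g z / (etal z - F z))) ->
  (forall z, 0 < z < c ->
     F z < etar z /\ is_derive etar z (- g z / (etar z - F z))) ->
  etal 0 <= v + F c -> etar 0 <= etal 0.
Proof.
  intros H Hc0 Hc Hv HI HH2 Cl Cr El Er Hl Hr Hv0.
  assert (Ha := H1_a_pos _ _ _ H).
  destruct (frozen_branches F g a c v) as
    [j0 [xl [xr [Hj0 [Cxl [Cxr [El0 [El1 [Er0 [Er1 Hj]]]]]]]]]]; trivial.
  assert (HF := frozen_branches_F_le F g a c v j0 xl xr H Hc0 Hc Hv HH2
    Cxl Cxr El0 El1 Er0 Er1 Hj).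
  set (D := fun j => etar (xr j) - etal (xl j)).
  assert (HDc : forall j, continuous D j).
  { intros j; apply (continuous_minus (fun j => etar (xr j)) (fun j => etal (xl j)));
      [apply (continuous_comp xr etar)|apply (continuous_comp xl etal)]; auto. }
  apply Rnot_lt_le; intros C.
  destruct (last_zero D j0 0) as [z [Hz [Ez Hpos]]]; [lra|auto| | |].
  - unfold D; rewrite El0, Er0, El, Er; lra.
  - unfold D; rewrite El1, Er1; lra.
  - set (dD := fun j =>
      (v + F c - F (xl j)) / (etal (xl j) - F (xl j))
      - (v + F c - F (xr j)) / (etar (xr j) - F (xr j))).
    assert (- D z <= - D 0).
    { apply (derive_nonneg_le (fun j => - D j) dD); [lra| | |].
      - intros j Hjz; destruct (Hj j ltac:(lra)) as [A [B [DA DB]]].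
        assert (GA := H1_g_neg _ _ _ (xl j) H ltac:(lra)).
        assert (GB := H1_g_pos _ _ _ H (xr j) ltac:(lra)).
        destruct (Hl _ A) as [PA QA], (Hr _ B) as [PB QB].
        replace (dD j) with (- (
          (F (xr j) - F c - v) / g (xr j) * (- g (xr j) / (etar (xr j) - F (xr j)))
          - (F (xl j) - F c - v) / g (xl j) * (- g (xl j) / (etal (xl j) - F (xl j))))).
        + apply (is_derive_opp D), (is_derive_minus (fun j => etar (xr j)) (fun j => etal (xl j))).
          * apply (is_derive_comp etar xr); assumption.
          * apply (is_derive_comp etal xl); assumption.
        + unfold dD; field; repeat split; lra.
      - intros j _; apply (continuous_opp D), HDc.
      - intros j Hjz; destruct (Hj j ltac:(lra)) as [A [B _]].
        destruct (Hl _ A) as [PA QA], (Hr _ B) as [PB QB].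
        assert (HFj := HF j ltac:(lra)).
        assert (HD := Hpos j ltac:(lra)); unfold D in HD.
        assert (HFl := H1_F_le_Fc F g a c (xl j) H Hc0 Hc ltac:(lra)).
        assert (Hup : etal (xl j) <= etal 0).
        { apply (derive_nonneg_le etal (fun z => - g z / (etal z - F z))); [lra| |auto|];
            intros w Hw; destruct (Hl w ltac:(lra)) as [PW QW]; [exact QW|].
          left; apply Rdiv_lt_0_compat; [|lra].
          assert (G := H1_g_neg _ _ _ w H ltac:(lra)); lra. }
        (* Over a common denominator, the numerator of [dD] splits into two nonnegative products.
           The first uses [D > 0]; the second uses that the left graph stays below [v + F c] and
           that [F] is smaller on the right branch. *)
        assert (0 <= (v + F c - F (xl j)) * (etar (xr j) - etal (xl j)))
          by (apply Rmult_le_pos; lra).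
        assert (0 <= (v + F c - etal (xl j)) * (F (xl j) - F (xr j)))
          by (apply Rmult_le_pos; lra).
        replace (dD j) with
          (((v + F c - F (xl j)) * (etar (xr j) - etal (xl j))
            + (v + F c - etal (xl j)) * (F (xl j) - F (xr j)))
           / ((etal (xl j) - F (xl j)) * (etar (xr j) - F (xr j))))
          by (unfold dD; field; split; lra).
        apply Rdiv_le_0_compat; [lra|apply Rmult_lt_0_compat; lra]. }
    specialize (Hpos 0 ltac:(lra)); lra.
Qed.

(** * Orbits that start above one of the two graphs *)

Lemma solves_at_continuous (F g x y : R -> R) (t : R) :
  solves_at F g x y t -> continuous x t /\ continuous y t.
Proof. intros [Hx Hy]; split; eapply is_derive_cont; eassumption. Qed.

(** Both the orbit and the graph solve the same equation, so their height difference obeys a linear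
    one whose coefficient has the sign of [g]: a positive height grows where [x > 0] and decays at a
    controlled rate where [x < 0]. *)
Lemma height_above_graph_derive (F g x y eta : R -> R) (t : R) :
  solves_at F g x y t -> F (x t) < eta (x t) ->
  is_derive eta (x t) (- g (x t) / (eta (x t) - F (x t))) ->
  is_derive (fun t => y t - eta (x t)) t
    (g (x t) / (eta (x t) - F (x t)) * (y t - eta (x t))).
Proof.
  intros [Hx Hy] HF Heta.
  replace (g (x t) / (eta (x t) - F (x t)) * (y t - eta (x t)))
    with (- g (x t) - (y t - F (x t)) * (- g (x t) / (eta (x t) - F (x t))))
    by (field; lra).
  apply (is_derive_minus y (fun t => eta (x t))); [exact Hy|].
  now apply (is_derive_comp eta x).
Qed.

Lemma left_graph_ge (F g : R -> R) (a c : R) (eta : R -> R) :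
  H1 F g a ->
  (forall z, continuous eta z) -> eta (- a) = F c ->
  (forall z, - a < z < 0 ->
     F z < eta z /\ is_derive eta z (- g z / (eta z - F z))) ->
  F c <= eta 0.
Proof.
  intros H Hcont Ea Heta.
  assert (Ha := H1_a_pos _ _ _ H); rewrite <- Ea.
  apply (derive_nonneg_le eta (fun z => - g z / (eta z - F z))); [lra| |auto|];
    intros z Hz; destruct (Heta z Hz) as [A B]; [exact B|].
  left; apply Rdiv_lt_0_compat; [|lra].
  assert (G := H1_g_neg _ _ _ z H ltac:(lra)); lra.
Qed.

Lemma right_graph_ge (F g : R -> R) (a c : R) (eta : R -> R) :
  H1 F g a -> 0 < c ->
  (forall z, continuous eta z) -> eta c = F c ->
  (forall z, 0 < z < c ->
     F z < eta z /\ is_derive eta z (- g z / (eta z - F z))) ->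
  F c <= eta 0.
Proof.
  intros H Hc0 Hcont Ec Heta.
  rewrite <- Ec; apply Ropp_le_cancel.
  apply (derive_nonneg_le (fun z => - eta z) (fun z => - (- g z / (eta z - F z))));
    [lra| |intros; apply (continuous_opp eta); auto|];
    intros z Hz; destruct (Heta z Hz) as [A B]; [now apply (is_derive_opp eta)|].
  assert (G := H1_g_pos _ _ _ H z ltac:(lra)).
  replace (- (- g z / (eta z - F z))) with (g z / (eta z - F z)) by (field; lra).
  left; apply Rdiv_lt_0_compat; lra.
Qed.

(** Up to the first zero of the height [D] the orbit is above the curve, so [x] increases. On the
    left [D] may shrink, and a Gronwall estimate keeps it from vanishing. *)
Lemma stays_above_left (F g x y eta : R -> R) (a c s e : R) :
  H1 F g a -> 0 < c -> F c = F (- a) ->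
  (forall z, continuous eta z) -> (forall z, z <= - a -> eta z = F c) ->
  (forall z, - a < z < 0 ->
     F z < eta z /\ is_derive eta z (- g z / (eta z - F z))) ->
  (forall t, s <= t <= e -> solves_at F g x y t) ->
  x s = - a -> F c < y s -> (forall t, s <= t <= e -> x t <= 0) ->
  forall t, s <= t <= e -> eta (x t) < y t.
Proof.
  intros H Hc0 Hc Hcont Hlo Heta Hsol Exs Hys Hx0 t0 Ht0.
  assert (Ha := H1_a_pos _ _ _ H).
  assert (Heta0 := left_graph_ge F g a c eta H Hcont (Hlo (- a) ltac:(lra)) Heta).
  assert (HF0 := odd_fun_0 F (H1_F_odd _ _ _ H)).
  assert (HFc := H1_Fc_pos F g a c H Hc).
  assert (HetaF : forall z, z <= 0 -> F z <= eta z).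
  { intros z Hz; destruct (Rle_lt_dec z (- a)) as [A|A].
    - rewrite Hlo by exact A; apply (H1_F_le_Fc F g a); trivial; lra.
    - destruct (Req_dec z 0) as [->|B]; [lra|].
      left; apply Heta; lra. }
  set (D := fun t => y t - eta (x t)).
  assert (HD : forall t, s <= t <= e -> continuous D t).
  { intros t Ht; destruct (solves_at_continuous _ _ _ _ _ (Hsol t Ht)) as [A B].
    apply (continuous_minus y (fun t => eta (x t))); [exact B|].
    now apply (continuous_comp x eta). }
  apply Rnot_le_lt; intros C.
  destruct (first_zero D s t0) as [z [Hz [Ez Hpos]]];
    [lra|intros; apply HD; lra|unfold D; rewrite Hlo; lra|unfold D; lra|].
  assert (Hinc : forall t t', s <= t -> t < t' -> t' <= z -> x t < x t').
  { intros t t' Ht Htt' Ht'.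
    apply (derive_pos_lt x (fun t => y t - F (x t)) t t' Htt').
    - intros w Hw; apply Hsol; lra.
    - intros w Hw; apply (solves_at_continuous F g x y), Hsol; lra.
    - intros w Hw; specialize (Hpos w ltac:(lra)); unfold D in Hpos.
      specialize (HetaF (x w) (Hx0 w ltac:(lra))); lra. }
  (* Starting from an intermediate time keeps [x] away from [-a], where [eta - F] vanishes and
     [kappa] has no bound. *)
  set (m := (s + z) / 2).
  assert (Hm : s < m < z) by (unfold m; lra).
  assert (Hxm : - a < x m < 0).
  { assert (A := Hinc s m ltac:(lra) ltac:(lra) ltac:(lra)).
    assert (B := Hinc m z ltac:(lra) ltac:(lra) ltac:(lra)).
    specialize (Hx0 z ltac:(lra)); lra. }
  set (kappa := fun w => - g w / (eta w - F w)).
  destruct (continuity_ab_maj kappa (x m) 0) as [w0 [Hmax _]]; [lra| |].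
  { intros w Hw; apply continuous_pt; unfold kappa, Rdiv.
    assert (F w < eta w).
    { destruct (Req_dec w 0) as [->|]; [lra|apply Heta; lra]. }
    apply (continuous_mult (fun w => - g w)).
    - apply (continuous_opp g), C1_continuous, H.
    - apply continuous_Rinv_comp; [|lra].
      apply (continuous_minus eta F); [auto|apply C1_continuous, H]. }
  set (K := kappa w0).
  (* Here [D' = - kappa D] with [kappa <= K], so [D] times [exp (K t)] is nondecreasing while [D] is
     positive. *)
  assert (HE : D m * exp (K * m) <= D z * exp (K * z)).
  { apply (derive_nonneg_le (fun t => D t * exp (K * t))
      (fun t => (K - kappa (x t)) * D t * exp (K * t))); [lra| | |].
    - intros t Ht.
      assert (A := Hinc m t ltac:(lra) ltac:(lra) ltac:(lra)).
      assert (B := Hinc t z ltac:(lra) ltac:(lra) ltac:(lra)).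
      assert (B' := Hx0 z ltac:(lra)).
      destruct (Heta (x t) ltac:(lra)) as [PA PB].
      replace ((K - kappa (x t)) * D t * exp (K * t)) with
        ((g (x t) / (eta (x t) - F (x t)) * (y t - eta (x t))) * exp (K * t)
         + D t * (K * exp (K * t)))
        by (unfold kappa, D; field; lra).
      apply (is_derive_mult D (fun t => exp (K * t))); [| |intros; apply Rmult_comm].
      + apply (height_above_graph_derive F g x y eta); trivial; apply Hsol; lra.
      + auto_derive; [exact I|ring].
    - intros t Ht; apply (continuous_mult D (fun t => exp (K * t))); [apply HD; lra|].
      apply (is_derive_cont _ _ (K * exp (K * t))); auto_derive; [exact I|ring].
    - intros t Ht.
      assert (A := Hinc m t ltac:(lra) ltac:(lra) ltac:(lra)).
      specialize (Hmax (x t) (conj (Rlt_le _ _ A) (Hx0 t ltac:(lra)))).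
      specialize (Hpos t ltac:(lra)).
      apply Rmult_le_pos; [apply Rmult_le_pos; unfold K; lra|left; apply exp_pos]. }
  rewrite Ez, Rmult_0_l in HE.
  specialize (Hpos m ltac:(lra)); assert (X := exp_pos (K * m)); nra.
Qed.

(** Up to a first zero of the height over [eta], [x] increases from [0], so [g] is positive and the
    height does not decrease: it cannot reach [0]. The graph itself lies on or above the curve. *)
Lemma stays_above_right (F g x y eta : R -> R) (a c s e : R) :
  H1 F g a -> 0 < c -> F c = F (- a) ->
  (forall z, continuous eta z) -> (forall z, z <= 0 -> eta z = eta 0) ->
  eta c = F c ->
  (forall z, 0 < z < c ->
     F z < eta z /\ is_derive eta z (- g z / (eta z - F z))) ->
  (forall t, s <= t <= e -> solves_at F g x y t) ->
  x s = 0 -> eta 0 < y s -> (forall t, s <= t <= e -> x t <= c) ->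
  forall t, s <= t <= e -> F (x t) < y t.
Proof.
  intros H Hc0 Hc Hcont Hlo Ec Heta Hsol Exs Hys Hxc t0 Ht0.
  assert (Heta0 := right_graph_ge F g a c eta H Hc0 Hcont Ec Heta).
  assert (HetaF : forall z, z <= c -> F z <= eta z).
  { intros z Hz; assert (A := H1_F_le_Fc F g a c z H Hc0 Hc Hz).
    destruct (Rle_lt_dec z 0) as [B|B]; [rewrite Hlo by exact B; lra|].
    destruct (Req_dec z c) as [->|]; [lra|left; apply Heta; lra]. }
  set (D := fun t => y t - eta (x t)).
  assert (HD : forall t, s <= t <= e -> continuous D t).
  { intros t Ht; destruct (solves_at_continuous _ _ _ _ _ (Hsol t Ht)) as [A B].
    apply (continuous_minus y (fun t => eta (x t))); [exact B|].
    now apply (continuous_comp x eta). }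
  assert (HDpos : 0 < D t0).
  { apply Rnot_le_lt; intros C.
    destruct (first_zero D s t0) as [z [Hz [Ez Hpos]]];
      [lra|intros; apply HD; lra|unfold D; rewrite Exs; lra|exact C|].
    assert (Hinc : forall t t', s <= t -> t < t' -> t' <= z -> x t < x t').
    { intros t t' Ht Htt' Ht'.
      apply (derive_pos_lt x (fun t => y t - F (x t)) t t' Htt').
      - intros w Hw; apply Hsol; lra.
      - intros w Hw; apply (solves_at_continuous F g x y), Hsol; lra.
      - intros w Hw; specialize (Hpos w ltac:(lra)); unfold D in Hpos.
        specialize (HetaF (x w) (Hxc w ltac:(lra))); lra. }
    assert (Hxi : forall t, s < t < z -> 0 < x t < c).
    { intros t Ht.
      assert (A := Hinc s t ltac:(lra) ltac:(lra) ltac:(lra)).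
      assert (B := Hinc t z ltac:(lra) ltac:(lra) ltac:(lra)).
      specialize (Hxc z ltac:(lra)); lra. }
    assert (D s <= D z).
    { apply (derive_nonneg_le D
        (fun t => g (x t) / (eta (x t) - F (x t)) * (y t - eta (x t)))); [lra| | |].
      - intros t Ht; destruct (Heta (x t) (Hxi t Ht)) as [PA PB].
        apply (height_above_graph_derive F g x y eta); trivial; apply Hsol; lra.
      - intros t Ht; apply HD; lra.
      - intros t Ht; destruct (Heta (x t) (Hxi t Ht)) as [PA PB].
        specialize (Hpos t ltac:(lra)); unfold D in Hpos.
        assert (G := H1_g_pos _ _ _ H (x t) ltac:(apply Hxi; lra)).
        apply Rmult_le_pos; [left; apply Rdiv_lt_0_compat|]; lra. }
    specialize (Hpos s ltac:(lra)); lra. }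
  unfold D in HDpos; specialize (HetaF (x t0) (Hxc t0 Ht0)); lra.
Qed.

(* Since [F' (-a) = 0], [y - F x] has the positive derivative [g a] at time [z]:
   were it nonpositive there, [x] would decrease to [-a]. *)
Lemma crossing_height (F g x y : R -> R) (a t z : R) :
  H1 F g a -> t < z ->
  (forall w, t <= w <= z -> solves_at F g x y w) ->
  (forall w, t <= w < z -> x w < - a) -> x z = - a -> F (- a) < y z.
Proof.
  intros H Htz Hsol Hlt Ez.
  apply Rnot_le_lt; intros C.
  set (v := fun w => y w - F (x w)).
  set (dv := fun w => - g (x w) - v w * Derive F (x w)).
  assert (Hv : forall w, t <= w <= z -> is_derive v w (dv w)).
  { intros w Hw; destruct (Hsol w Hw) as [A B].
    apply (is_derive_minus y (fun w => F (x w))); [exact B|].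
    apply (is_derive_comp F x); [apply C1_is_derive, H|exact A]. }
  assert (Hdvz : 0 < dv z).
  { unfold dv; rewrite Ez, odd_Derive_even by apply H.
    rewrite (H1_a_zero _ _ _ H).
    assert (Ha := H1_a_pos _ _ _ H).
    assert (G := H1_g_neg _ _ _ (- a) H ltac:(lra)); lra. }
  destruct (continuous_pos_near dv z) as [d Hd]; [|exact Hdvz|].
  { destruct (solves_at_continuous _ _ _ _ _ (Hsol z ltac:(lra))) as [A B].
    apply (continuous_minus (fun w => - g (x w)) (fun w => v w * Derive F (x w))).
    - apply (continuous_opp (fun w => g (x w))), (continuous_comp x g); [exact A|].
      apply C1_continuous, H.
    - apply (continuous_mult v (fun w => Derive F (x w))).
      + eapply is_derive_cont, Hv; lra.
      + apply (continuous_comp x (Derive F)); [exact A|apply (H1_F_C1 _ _ _ H)]. }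
  assert (Hd0 := cond_pos d).
  set (m := Rmax t (z - d / 2)).
  assert (Hm : t <= m < z /\ z - d < m).
  { unfold m, Rmax; destruct Rle_dec; lra. }
  assert (Hvneg : forall w, m <= w < z -> v w < 0).
  { intros w Hw; assert (v w < v z).
    { apply (derive_pos_lt v dv); [lra|intros; apply Hv; lra| |].
      - intros u Hu; eapply is_derive_cont, Hv; lra.
      - intros u Hu; apply Hd, Rabs_def1; lra. }
    unfold v at 2 in H0; rewrite Ez in H0; lra. }
  assert (- x m < - x z).
  { apply (derive_pos_lt (fun w => - x w) (fun w => - v w)); [lra| | |].
    - intros w Hw; apply (is_derive_opp x), Hsol; lra.
    - intros w Hw; apply (continuous_opp x), (solves_at_continuous F g x y), Hsol; lra.
    - intros w Hw; specialize (Hvneg w ltac:(lra)); lra. }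
  specialize (Hlt m ltac:(lra)); lra.
Qed.

(** * No periodic orbit with [x <= c] goes left of [-a] *)

Lemma no_bounded_cycle_from_left (F g x y etal etar : R -> R) (a c T t0 : R) :
  H1 F g a -> 0 < c -> F c = F (- a) ->
  (forall z, continuous etal z) -> (forall z, z <= - a -> etal z = F c) ->
  (forall z, - a < z < 0 ->
     F z < etal z /\ is_derive etal z (- g z / (etal z - F z))) ->
  (forall z, continuous etar z) -> (forall z, z <= 0 -> etar z = etar 0) ->
  etar c = F c ->
  (forall z, 0 < z < c ->
     F z < etar z /\ is_derive etar z (- g z / (etar z - F z))) ->
  etar 0 <= etal 0 ->
  (forall t, solves_at F g x y t) -> 0 < T ->
  (forall t, x (t + T) = x t /\ y (t + T) = y t) ->
  (forall t, x t <= c) -> x t0 < - a -> False.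
Proof.
  intros H Hc0 Hc Cl Ll Hl Cr Lr Er Hr Hle Hsol HT Hper Hxc Ht0.
  assert (Ha := H1_a_pos _ _ _ H).
  assert (Cx : forall t, continuous x t)
    by (intros t; apply (solves_at_continuous F g x y), Hsol).
  assert (Cy : forall t, continuous y t)
    by (intros t; apply (solves_at_continuous F g x y), Hsol).
  (* If [x] stayed negative after [s], then [y' = - g x > 0] would make [y] strictly larger after a
     period. *)
  assert (Hreturn : forall s, exists t, s < t /\ 0 <= x t).
  { intros s; destruct (Classical_Prop.classic (exists t, s < t /\ 0 <= x t)) as [|N];
      [assumption|exfalso].
    assert (y s < y (s + T)).
    { apply (derive_pos_lt y (fun t => - g (x t))); [lra| |auto|].
      - intros t _; apply Hsol.
      - intros t Ht; assert (x t < 0).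
        { apply Rnot_le_lt; intros C; apply N; exists t; lra. }
        assert (G := H1_g_neg _ _ _ (x t) H ltac:(lra)); lra. }
    rewrite (proj2 (Hper s)) in H0; lra. }
  destruct (Hreturn t0) as [t1 [Ht1 Hxt1]].
  destruct (first_zero (fun t => - (x t + a)) t0 t1) as [s [Hs [Es Hbefore]]];
    [lra| |lra|lra|].
  { intros t _; apply (continuous_opp (fun t => x t + a)).
    apply (continuous_plus x (fun _ => a)); [auto|apply continuous_const]. }
  assert (Hys : F (- a) < y s).
  { apply (crossing_height F g x y a t0 s H); [lra|auto| |lra].
    intros w Hw; specialize (Hbefore w Hw); lra. }
  destruct (Hreturn s) as [t2 [Ht2 Hxt2]].
  destruct (first_zero (fun t => - x t) s t2) as [r [Hr' [Err Hneg]]];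
    [lra|intros; apply (continuous_opp x); auto|lra|lra|].
  assert (Hyr : etal (x r) < y r).
  { apply (stays_above_left F g x y etal a c s r); auto; try lra.
    intros t Ht; destruct (Req_dec t r) as [->|]; [lra|].
    specialize (Hneg t ltac:(lra)); lra. }
  replace (x r) with 0 in Hyr by lra.
  (* From time [r] on, the bound [x <= c] keeps the orbit above the curve, so [x] increases strictly
     over a full period. *)
  assert (x r < x (r + T)); [|rewrite (proj1 (Hper r)) in *; lra].
  apply (derive_pos_lt x (fun t => y t - F (x t))); [lra| |auto|].
  - intros t _; apply Hsol.
  - intros t Ht.
    assert (A := stays_above_right F g x y etar a c r (r + T) H Hc0 Hc Cr Lr Er Hr
      (fun t _ => Hsol t) ltac:(lra) ltac:(lra) (fun t _ => Hxc t) t ltac:(lra)); lra.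
Qed.

(** * Periodic functions, and periodic orbits leaving the strip [|x| <= a] *)

Lemma periodic_translate (f : R -> R) (T t : R) :
  0 < T -> (forall s, f (s + T) = f s) ->
  exists s, 0 <= s <= T /\ f s = f t.
Proof.
  intros HT Hper.
  assert (Hn : forall n s, f (s + INR n * T) = f s).
  { induction n as [|n IH]; intros s.
    - simpl; f_equal; ring.
    - rewrite S_INR, <- (IH s), <- (Hper (s + INR n * T)); f_equal; ring. }
  assert (Hz : forall k s, f (s + IZR k * T) = f s).
  { intros [|p|p] s.
    - f_equal; ring.
    - rewrite <- (Hn (Pos.to_nat p) s), INR_IPR; reflexivity.
    - rewrite <- (Hn (Pos.to_nat p) (s + _)), INR_IPR.
      f_equal; change (IZR (Z.neg p)) with (- IPR p); ring. }
  destruct (archimed (t / T)) as [A B].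
  (* [up r] is the floor of [r] plus one, so [1 - up (t / T)] is minus the floor of [t / T]. *)
  exists (t + IZR (1 - up (t / T)) * T); split; [|apply Hz].
  rewrite minus_IZR.
  assert (E : t = t / T * T) by (field; lra).
  split; nra.
Qed.

Lemma periodic_max (f : R -> R) (T : R) :
  0 < T -> (forall s, f (s + T) = f s) -> (forall s, continuous f s) ->
  exists m, forall t, f t <= f m.
Proof.
  intros HT Hper Hc.
  destruct (continuity_ab_maj f 0 T) as [m [Hm _]];
    [lra|intros; now apply continuous_pt|].
  exists m; intros t; destruct (periodic_translate f T t HT Hper) as [s [Hs <-]].
  now apply Hm.
Qed.

(* The energy [y^2/2 + RInt g 0 x] has derivative [- g x * F x], nonnegative as
   long as [|x| <= a]. *)
Lemma periodic_leaves_strip (F g x y : R -> R) (a T : R) :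
  H1 F g a -> 0 < T -> (forall t, solves_at F g x y t) ->
  (forall t, x (t + T) = x t /\ y (t + T) = y t) ->
  (exists t, (x t, y t) <> (x 0, y 0)) ->
  exists t, x t < - a \/ a < x t.
Proof.
  intros H HT Hsol Hper [t1 Ht1].
  destruct (Classical_Prop.classic (exists t, x t < - a \/ a < x t)) as [|N];
    [assumption|exfalso].
  assert (Hxa : forall t, - a <= x t <= a).
  { intros t; split; apply Rnot_lt_le; intros C; apply N; exists t; auto. }
  assert (HgF : forall z, - a <= z <= a -> z <> 0 -> 0 < - (g z * F z)).
  { intros z Hz Hz0; destruct (Rlt_le_dec 0 z) as [A|A].
    - assert (G := H1_g_pos _ _ _ H z A); assert (B := H1_F_neg F g a z H); nra.
    - assert (G := H1_g_pos _ _ _ H (- z) ltac:(lra)).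
      assert (B := H1_F_neg F g a (- z) H ltac:(lra)).
      rewrite (H1_g_odd _ _ _ H) in G; rewrite (H1_F_odd _ _ _ H) in B; nra. }
  set (E := fun t => y t * y t / 2 + RInt g 0 (x t)).
  assert (HE : forall t, is_derive E t (- (g (x t) * F (x t)))).
  { intros t; destruct (Hsol t) as [A B].
    replace (- (g (x t) * F (x t)))
      with (y t * - g (x t) + (y t - F (x t)) * g (x t)) by ring.
    apply (is_derive_plus (fun t => y t * y t / 2) (fun t => RInt g 0 (x t))).
    - auto_derive; [repeat split; now exists (- g (x t))|].
      change (fun x => y x) with y; rewrite (is_derive_unique y t _ B); field.
    - apply (is_derive_comp (RInt g 0) x); [|exact A].
      apply (is_derive_RInt g (RInt g 0) 0).
      + apply filter_forall; intros z; apply (RInt_correct g).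
        apply (ex_RInt_continuous g); intros; apply C1_continuous, H.
      + apply C1_continuous, H. }
  assert (CE : forall t, continuous E t) by (intros t; eapply is_derive_cont, HE).
  assert (Hnn : forall t, 0 <= - (g (x t) * F (x t))).
  { intros t; destruct (Req_dec (x t) 0) as [->|]; [|left; now apply HgF].
    rewrite (odd_fun_0 g) by apply H; lra. }
  assert (Hmon : forall s t, s <= t -> E s <= E t).
  { intros s t Hst; apply (derive_nonneg_le E (fun t => - (g (x t) * F (x t)))); auto. }
  (* A nondecreasing periodic function is constant. *)
  assert (Hconst : forall s t, t - T <= s <= t -> E s = E t).
  { intros s t Hst; apply Rle_antisym; [apply Hmon; lra|].
    replace (E t) with (E (t - T)); [apply Hmon; lra|].
    unfold E; destruct (Hper (t - T)) as [A B].
    replace (t - T + T) with t in A, B by ring; now rewrite A, B. }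
  assert (Hx0 : forall t, x t = 0).
  { intros t; destruct (Req_dec (x t) 0) as [|Hn]; [assumption|exfalso].
    assert (Hp := HgF (x t) (Hxa t) Hn).
    assert (Z : is_derive E t 0).
    { apply (is_derive_ext_loc (fun _ => E (t + T / 2)));
        [|apply (is_derive_const (E (t + T / 2)))].
      assert (HT2 : 0 < T / 2) by lra.
      exists (mkposreal _ HT2); intros s Hs.
      change (Rabs (s - t) < T / 2) in Hs; apply Rabs_def2 in Hs.
      symmetry; apply Hconst; lra. }
    assert (Q := is_derive_unique _ _ _ Z).
    rewrite (is_derive_unique _ _ _ (HE t)) in Q; lra. }
  (* With [x] identically [0], the first equation forces [y = F 0 = 0]: the orbit is the
     equilibrium. *)
  assert (Hy0 : forall t, y t = 0).
  { intros t; assert (Z : is_derive x t 0).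
    { apply (is_derive_ext (fun _ => 0)); [now intros|apply (is_derive_const 0)]. }
    assert (Q := is_derive_unique _ _ _ Z).
    rewrite (is_derive_unique _ _ _ (proj1 (Hsol t))), Hx0 in Q.
    rewrite (odd_fun_0 F) in Q by apply H; lra. }
  apply Ht1; now rewrite !Hx0, !Hy0.
Qed.

(** * Central symmetry, the two orbit graphs, and the amplitude bound *)

Lemma solves_at_opp (F g x y : R -> R) (t : R) :
  odd_fun F -> odd_fun g -> solves_at F g x y t ->
  solves_at F g (fun t => - x t) (fun t => - y t) t.
Proof.
  intros HF Hg [A B]; split.
  - replace (- y t - F (- x t)) with (- (y t - F (x t))) by (rewrite HF; ring).
    now apply (is_derive_opp x).
  - rewrite Hg; now apply (is_derive_opp y).
Qed.

(* The orientation of time in [Y_graph] is forced: an orbit above [y = F x]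
   moves to the right. *)
Lemma Y_graph_left (F g : R -> R) (x0 y0 Z : R) :
  x0 < 0 -> Y_graph F g x0 y0 0 Z ->
  exists eta : R -> R,
    (forall z, continuous eta z) /\
    (forall z, z <= x0 -> eta z = y0) /\ eta 0 = Z /\
    (forall z, x0 < z < 0 ->
       F z < eta z /\ is_derive eta z (- g z / (eta z - F z))).
Proof.
  intros Hx0 [_ [_ [x [y [t0 [t1 [Hsol [Hab [E0 [E0' [E1 E1']]]]]]]]]]].
  destruct (Rtotal_order t0 t1) as [Ht | [<- | Ht]]; [|lra|].
  - rewrite Rmin_left, Rmax_right in Hsol, Hab by lra.
    destruct (orbit_graph F g x y t0 t1 Ht Hsol Hab) as [_ [eta [A [B [C D]]]]].
    rewrite E0, E1 in *; exists eta; split; [exact A|split; [|split; [|exact D]]].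
    + intros z Hz; now rewrite B.
    + rewrite C; lra.
  - rewrite Rmin_right, Rmax_left in Hsol, Hab by lra.
    destruct (orbit_graph F g x y t1 t0 Ht Hsol Hab) as [Hlt _]; lra.
Qed.

Lemma Y_graph_right (F g : R -> R) (x0 y0 Z : R) :
  0 < x0 -> Y_graph F g x0 y0 0 Z ->
  exists eta : R -> R,
    (forall z, continuous eta z) /\
    (forall z, z <= 0 -> eta z = Z) /\ eta x0 = y0 /\
    (forall z, 0 < z < x0 ->
       F z < eta z /\ is_derive eta z (- g z / (eta z - F z))).
Proof.
  intros Hx0 [_ [_ [x [y [t0 [t1 [Hsol [Hab [E0 [E0' [E1 E1']]]]]]]]]]].
  destruct (Rtotal_order t0 t1) as [Ht | [<- | Ht]]; [|lra|].
  - rewrite Rmin_left, Rmax_right in Hsol, Hab by lra.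
    destruct (orbit_graph F g x y t0 t1 Ht Hsol Hab) as [Hlt _]; lra.
  - rewrite Rmin_right, Rmax_left in Hsol, Hab by lra.
    destruct (orbit_graph F g x y t1 t0 Ht Hsol Hab) as [_ [eta [A [B [C D]]]]].
    rewrite E0, E1 in *; exists eta; split; [exact A|split; [|split; [|exact D]]].
    + intros z Hz; now rewrite B.
    + rewrite C; lra.
Qed.

Theorem corollary1p1 (F g : R -> R) (a c v0 Y1 Y2 : R)
  (hH1 : H1 F g a)
  (hc_pos : 0 < c) (hc : F c = F (- a))
  (hH2 : H2 F g c)
  (hv0_pos : 0 < v0) (hv0 : I_int F g c v0 (- a) c = 0)
  (hY1 : Y_graph F g (- a) (F c) 0 Y1)
  (hY2 : Y_graph F g c (F c) 0 Y2)
  (hmin : Rmin Y1 Y2 <= v0 + F c)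
  (L : R * R -> Prop) (hL : limit_cycle F g L) :
  exists A : R, is_amplitude L A /\ A > c.
Proof.
  assert (Ha := H1_a_pos _ _ _ hH1).
  destruct (Y_graph_left F g (- a) (F c) Y1) as [etal [Cl [Ll [El Hl]]]];
    [lra|exact hY1|].
  destruct (Y_graph_right F g c (F c) Y2) as [etar [Cr [Lr [Er Hr]]]];
    [lra|exact hY2|].
  assert (Er0 : etar 0 = Y2) by (apply Lr; lra).
  (* Either [Y2 <= Y1] already, or the minimum is [Y1] and the clock comparison applies. *)
  assert (Hle : etar 0 <= etal 0).
  { destruct (Rle_lt_dec Y2 Y1) as [A|A]; [lra|].
    rewrite Rmin_left in hmin by lra.
    apply (left_height_le_right_height F g a c v0 etal etar); trivial.
    - apply Ll; lra.
    - lra. }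
  rewrite <- Er0 in Lr.
  destruct hL as [[x [y [T [Hsol [HT [Hper [Hne HL]]]]]]] _].
  destruct (periodic_max (fun t => Rabs (x t)) T HT) as [m Hm].
  { intros s; now rewrite (proj1 (Hper s)). }
  { intros s; apply (continuous_Rabs_comp x), (solves_at_continuous F g x y), Hsol. }
  exists (Rabs (x m)); split; [split|].
  - exists (x m, y m); split; [apply HL; now exists m|reflexivity].
  - intros q Hq; apply HL in Hq as [t ->]; apply Hm.
  (* A maximum of [|x|] at most [c] would confine the orbit to [|x| <= c]. *)
  - apply Rnot_le_gt; intros C.
    assert (Hxc : forall t, - c <= x t <= c).
    { intros t; apply Rabs_le_between; specialize (Hm t); simpl in Hm; lra. }
    destruct (periodic_leaves_strip F g x y a T hH1 HT Hsol Hper Hne) as [t [Ht|Ht]].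
    + apply (no_bounded_cycle_from_left F g x y etal etar a c T t); trivial.
      intros s; apply Hxc.
    (* An excursion beyond [a] becomes one beyond [-a] for the symmetric orbit. *)
    + apply (no_bounded_cycle_from_left F g (fun t => - x t) (fun t => - y t)
        etal etar a c T t); trivial.
      * intros s; apply solves_at_opp; [apply hH1|apply hH1|apply Hsol].
      * intros s; destruct (Hper s) as [A B]; now rewrite A, B.
      * intros s; specialize (Hxc s); lra.
      * lra.
Qed.
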